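(* Suppose that $\mathcal G$ and $\mathcal H$ are DAGs on $[p]$ with the same skeleton $G$, where $G$ is a tree. Assume that the edges that are directed differently in $\mathcal G$ and $\mathcal H$ form a subtree $T$ of $G$, and that $\Delta(\mathcal G,\mathcal H)\neq\emptyset$. Identify $T$ with its set of nodes where convenient. For a node $i$ of $T$ write $\{\mathfrak c_i\}=T\cap \mathrm{ch}_{\mathcal G}(i)$ and $\{\mathfrak p_i\}=T\cap\mathrm{pa}_{\mathcal G}(i)$ whenever these sets are singletons. Then the essential graphs of $\mathcal G$ and $\mathcal H$ form an essential flip if and only if every internal node $i$ of $T$ (node of degree at least $2$ in $T$) satisfies the condition corresponding to its type: (I) if $|T\cap\mathrm{pa}_{\mathcal G}(i)|\ge2$ and $|T\cap\mathrm{ch}_{\mathcal G}(i)|\ge 2$: no condition. (II) if $|T\cap\mathrm{pa}_{\mathcal G}(i)|\ge2$ and $|T\cap\mathrm{ch}_{\mathcal G}(i)|=0$: no condition. (III) if $|T\cap\mathrm{pa}_{\mathcal G}(i)|=0$ and $|T\cap\mathrm{ch}_{\mathcal G}(i)|\ge2$: no condition. (IV) if $|T\cap\mathrm{pa}_{\mathcal G}(i)|\ge2$ and $|T\cap\mathrm{ch}_{\mathcal G}(i)|=1$: either $|\mathrm{pa}_{\mathcal G}(i)\setminus T|\ge1$, or the following implication holds: if there is a v-structure at $\mathfrak c_i$ in $\mathcal G$, then $\mathfrak c_i$ has an essential parent in $\mathcal H$. (V) if $|T\cap\mathrm{pa}_{\mathcal G}(i)|=1$ and $|T\cap\mathrm{ch}_{\mathcal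 G}(i)|\ge2$: either $|\mathrm{pa}_{\mathcal G}(i)\setminus T|\ge1$, or the following implication holds: if there is a v-structure at $\mathfrak p_i$ in $\mathcal H$, then $\mathfrak p_i$ has an essential parent in $\mathcal G$. (VI) if $|T\cap\mathrm{pa}_{\mathcal G}(i)|=1$ and $|T\cap\mathrm{ch}_{\mathcal G}(i)|=1$: if there are nodes of $\Delta(\mathcal G,\mathcal H)$ in both connected components of $T\setminus\{i\}$, then either $|\mathrm{pa}_{\mathcal G}(i)\setminus T|\ge1$, or both $\mathfrak c_i$ has an essential parent in $\mathcal H$ and $\mathfrak p_i$ has an essential parent in $\mathcal G$.
   Context: $[p]=\{1,\dots,p\}$. For a DAG $\mathcal D$ on $[p]$, $\mathrm{pa}_{\mathcal D}(i)$ and $\mathrm{ch}_{\mathcal D}(i)$ are the sets of parents and children of $i$. The characteristic imset $c_{\mathcal D}$ is the vector indexed by all $S\subseteq[p]$, $|S|\ge2$, with $c_{\mathcal D}(S)=1$ if there is $i\in S$ with $S\setminus\{i\}\subseteq\mathrm{pa}_{\mathcal D}(i)$ and $0$ otherwise. The skeleton is the underlying undirected graph. A v-structure is an induced subgraph $a\to b\leftarrow c$; it is said to be at $b$. Two DAGs are Markov equivalent if they have the same skeleton and the same v-structures (equivalently, the same characteristic imset). The essential graph of a DAG $\mathcal D$ is the partially directed graph with the same skeleton in which an edge is directed $i\to j$ iff $i\to j$ in every DAG Markov equivalent to $\mathcal D$; such an arrow is called essential in $\mathcal D$. A node $j$ is an essential parent of $i$ in $\mathcal D$ if $j\to i$ in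 $\mathcal D$ and this arrow is essential. For an essential graph, its characteristic imset is that of any DAG in its equivalence class. For a tree $G$ with neighbour sets $\mathrm{ne}_G(i)$ let $N_i=\{S\subseteq[p]: i\in S\subseteq\mathrm{ne}_G(i)\cup\{i\},\ |S|\ge3\}$, and for DAGs (or essential graphs) $\mathcal G,\mathcal H$ with skeleton $G$ let $\Delta(\mathcal G,\mathcal H)=\{i\in[p]: c_{\mathcal G}|_{N_i}\neq c_{\mathcal H}|_{N_i}\}$. $\operatorname{span}(\Delta)$ is the unique minimal subtree of $G$ containing $\Delta$, and $\mathcal G|_A$ is the induced subgraph on $A$. Essential flip: two essential graphs $\mathcal G',\mathcal H'$ with skeleton the tree $G$ form an essential flip if they are not Markov equivalent, $\mathcal G'|_{\operatorname{span}(\Delta)}$ and $\mathcal H'|_{\operatorname{span}(\Delta)}$ contain no undirected edges, and every edge of $G|_{\operatorname{span}(\Delta)}$ is directed differently in $\mathcal G'$ and $\mathcal H'$, where $\Delta=\Delta(\mathcal G',\mathcal H')$. *)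

(* Defs.v *)
From mathcomp Require Import all_boot.

Set Implicit Arguments.
Unset Strict Implicit.
Unset Printing Implicit Defensive.

(* An edge set on V. As a directed graph, (x, y) stands for the arc x -> y;
   an undirected graph contains both orientations of each of its edges. *)
Notation edges V := {set V * V}.

Definition edge_rel (V : finType) (E : edges V) : rel V :=
  [rel x y | (x, y) \in E].

Definition induced (V : finType) (E : edges V) (A : {set V}) : edges V :=
  [set e in E | (e.1 \in A) && (e.2 \in A)].

(* The undirected graph with node set A and edge set E is a tree: simple,
   connected and without cycles. Repetition-free cycles have at most #|V|
   nodes, so bounding the length n loses nothing. The empty graph counts as a
   tree, so that the span of the empty set is empty. *)
Definition is_tree (V : finType) (A : {set V}) (E : edges V) : bool :=
  [&& [forall x, forall y, ((x, y) \in E) ==>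
         [&& x != y, (y, x) \in E, x \in A & y \in A]],
      [forall x in A, forall y in A, connect (edge_rel E) x y] &
      [forall n : 'I_(#|V|.+1), forall c : n.-tuple V,
         (2 < n) ==> ~~ (cycle (edge_rel E) c && uniq c)]].

Definition components (V : finType) (A : {set V}) (E : edges V) :
    {set {set V}} :=
  equivalence_partition (connect (edge_rel (induced E A))) A.

(* The node set of the minimal subtree of G containing D. It exists and is
   unique when G is a tree, which is the only case of interest. *)
Definition span (V : finType) (G : edges V) (D : {set V}) : {set V} :=
  odflt set0
    [pick A | minset (fun B => is_tree B (induced G B) && (D \subset B)) A].

Definition is_dag (V : finType) (D : edges V) : bool :=
  [forall x, forall y, ((x, y) \in D) ==> ~~ connect (edge_rel D) y x].

Definition parents (V : finType) (D : edges V) (i : V) : {set V} :=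
  [set j | (j, i) \in D].

Definition children (V : finType) (D : edges V) (i : V) : {set V} :=
  [set j | (i, j) \in D].

Definition skeleton (V : finType) (D : edges V) : edges V :=
  [set e | (e \in D) || ((e.2, e.1) \in D)].

(* A partially directed graph: its skeleton and its set of arcs. An edge of
   the skeleton carrying no arc is undirected. *)
Notation pdag V := (edges V * edges V)%type.

Definition pdag_of (V : finType) (D : edges V) : pdag V := (skeleton D, D).

Definition undirected_edges (V : finType) (P : pdag V) : edges V :=
  [set e in P.1 | (e \notin P.2) && ((e.2, e.1) \notin P.2)].

Definition pinduced (V : finType) (P : pdag V) (A : {set V}) : pdag V :=
  (induced P.1 A, induced P.2 A).

(* The v-structure a -> b <- c, at b. *)
Definition v_structure (V : finType) (P : pdag V) (a b c : V) : bool :=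
  [&& (a, b) \in P.2, (c, b) \in P.2, a != c & (a, c) \notin P.1].

Definition has_v_structure_at (V : finType) (D : edges V) (b : V) : bool :=
  [exists a, exists c, v_structure (pdag_of D) a b c].

(* For two essential graphs this says that their classes coincide, since all
   arcs of a v-structure are essential. *)
Definition markov_equiv (V : finType) (P Q : pdag V) : bool :=
  (P.1 == Q.1) &&
  [forall a, forall b, forall c, v_structure P a b c == v_structure Q a b c].

Definition essential_arcs (V : finType) (D : edges V) : edges V :=
  [set e | [forall D' : edges V,
     is_dag D' && markov_equiv (pdag_of D) (pdag_of D') ==> (e \in D')]].

Definition essential_graph (V : finType) (D : edges V) : pdag V :=
  (skeleton D, essential_arcs D).

Definition essential_parents (V : finType) (D : edges V) (i : V) : {set V} :=
  [set j in parents D i | (j, i) \in essential_arcs D].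

Notation imset_index V := {S : {set V} | 1 < #|S|}.

Definition char_imset (V : finType) (D : edges V) :
    {ffun imset_index V -> nat} :=
  [ffun S : imset_index V =>
     if [exists i in val S, val S :\ i \subset parents D i] then 1 else 0].

(* The characteristic imset of an arbitrary DAG whose essential graph is P
   (they all have the same one). *)
Definition ess_imset (V : finType) (P : pdag V) :
    {ffun imset_index V -> nat} :=
  oapp (@char_imset V) [ffun=> 0]
    [pick D : edges V | is_dag D && (essential_graph D == P)].

Definition star_sets (V : finType) (G : edges V) (i : V) :
    {set imset_index V} :=
  [set S : imset_index V |
     [&& i \in val S, val S \subset i |: [set j | (i, j) \in G]
       & 3 <= #|val S|]].

Definition Delta (V : finType) (G : edges V)
    (c1 c2 : {ffun imset_index V -> nat}) : {set V} :=
  [set i | [exists S : imset_index V, (S \in star_sets G i) && (c1 S != c2 S)]].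

(* The edges, in both orientations, carrying opposite arcs in A1 and A2. *)
Definition diff_edges (V : finType) (A1 A2 : edges V) : edges V :=
  [set e | ((e \in A1) && ((e.2, e.1) \in A2)) ||
           (((e.2, e.1) \in A1) && (e \in A2))].

Definition diff_nodes (V : finType) (A1 A2 : edges V) : {set V} :=
  [set x | [exists y, (x, y) \in diff_edges A1 A2]].

Definition is_essential_graph (V : finType) (P : pdag V) : bool :=
  [exists D : edges V, is_dag D && (essential_graph D == P)].

Definition essential_flip (V : finType) (G : edges V) (P Q : pdag V) : Prop :=
  let S := span G (Delta G (ess_imset P) (ess_imset Q)) in
  [/\ is_tree [set: V] G,
      [/\ is_essential_graph P, is_essential_graph Q, P.1 = G & Q.1 = G],
      ~~ markov_equiv P Q,
      undirected_edges (pinduced P S) = set0 /\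
      undirected_edges (pinduced Q S) = set0
    & induced G S \subset diff_edges P.2 Q.2].

Definition cond_IV (V : finType) (G H : edges V) (T : {set V}) (i : V) :=
  2 <= #|T :&: parents G i| ->
  forall c, T :&: children G i = [set c] ->
  1 <= #|parents G i :\: T| \/
  (has_v_structure_at G c -> exists j, j \in essential_parents H c).

Definition cond_V (V : finType) (G H : edges V) (T : {set V}) (i : V) :=
  forall q, T :&: parents G i = [set q] ->
  2 <= #|T :&: children G i| ->
  1 <= #|parents G i :\: T| \/
  (has_v_structure_at H q -> exists j, j \in essential_parents G q).

(* Here T is a node set and ET the edge set of the subtree on it. *)
Definition cond_VI (V : finType) (G H : edges V) (T : {set V}) (ET : edges V)
    (D : {set V}) (i : V) :=
  forall q c, T :&: parents G i = [set q] -> T :&: children G i = [set c] ->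
  (forall K, K \in components (T :\ i) ET -> K :&: D != set0) ->
  1 <= #|parents G i :\: T| \/
  ((exists j, j \in essential_parents H c) /\
   (exists j, j \in essential_parents G q)).

(* Main.v *)
Require Import Defs.
From mathcomp Require Import all_boot.

(* In an orientation D of a tree, an arc x -> y is essential iff y has another
   parent or x has an essential parent: if neither holds, every ancestor of y
   has at most one parent, and reversing all arcs into ancestors of y gives a
   Markov equivalent DAG. Moreover i lies in Delta iff the v-structures of G
   and H at i differ, so that S = span(Delta) is contained in T, and the
   essential graphs form an essential flip iff every edge inside S is essential
   in both G and H.
   If this holds, the conditions follow at i by looking at the edges of S
   between i and c_i, p_i. Conversely, let a -> b in G be an edge of S with a
   the only parent of b. If a (resp. b) is not in Delta, then by minimality of
   S it is of type VI with Delta on both sides, and condition VI gives a an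
   essential parent. If both are in Delta, then b is of type V, and either a
   has two parents in G or it has a v-structure in H, so that condition V
   applies. The claim for H follows by exchanging G and H. *)

Set Implicit Arguments.
Unset Strict Implicit.
Unset Printing Implicit Defensive.

(** * Trees: cut edges and simple paths *)

Section Trees.

Variables (V : finType) (A : {set V}) (E : edges V).
Hypothesis treeE : is_tree A E.

Lemma tree_neq x y : (x, y) \in E -> x != y.
Proof. by case/and3P: treeE => /forallP/(_ x)/forallP/(_ y)/implyP eP _ _ /eP/andP[]. Qed.

Lemma tree_sym x y : ((x, y) \in E) = ((y, x) \in E).
Proof.
case/and3P: treeE => /forallP eP _ _.
apply/idP/idP => xyE; first by move/forallP/(_ y)/implyP/(_ xyE)/and4P: (eP x) => [[_]].
by move/forallP/(_ x)/implyP/(_ xyE)/and4P: (eP y) => [[_]].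
Qed.

Lemma tree_memr x y : (x, y) \in E -> y \in A.
Proof. by case/and3P: treeE => /forallP/(_ x)/forallP/(_ y)/implyP eP _ _ /eP/and4P[_ _ _]. Qed.

Lemma tree_meml x y : (x, y) \in E -> x \in A.
Proof. by rewrite tree_sym => /tree_memr. Qed.

Lemma tree_connect x y : x \in A -> y \in A -> connect (edge_rel E) x y.
Proof. by case/and3P: treeE => _ /forallP/(_ x)/implyP cP _ /cP/forallP/(_ y)/implyP. Qed.

(** This is the form in which acyclicity is used: a simple path closed by an edge has at most two
    nodes, the case of one edge walked back and forth. *)
Lemma tree_acyclic x p : path (edge_rel E) x p -> uniq (x :: p) ->
  (last x p, x) \in E -> size p <= 1.
Proof.
move=> xp uxp lE; rewrite leqNgt; apply/negP => szp.
case/and3P: treeE => _ _ /forallP cP.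
have szV : size (x :: p) < #|V|.+1.
  by rewrite ltnS -(card_uniqP uxp) max_card.
move/forallP/(_ (in_tuple (x :: p)))/implyP: (cP (Ordinal szV)) => /= /(_ szp).
by rewrite rcons_path xp -/(uniq (x :: p)) uxp /= {1}/edge_rel /= lE.
Qed.

Lemma tree_no_triangle a b c :
  (a, b) \in E -> (b, c) \in E -> a != c -> (a, c) \notin E.
Proof.
move=> ab bc ac; apply/negP => acE.
suff: size [:: b; c] <= 1 by [].
apply: (@tree_acyclic a); last by rewrite tree_sym.
  by rewrite /= /edge_rel /= ab bc.
by rewrite /= !inE negb_or (tree_neq ab) ac (tree_neq bc).
Qed.

Definition remove_edge u v : edges V := E :\ (u, v) :\ (v, u).

Lemma remove_edge_sym u v x y :
  ((x, y) \in remove_edge u v) = ((y, x) \in remove_edge u v).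
Proof. by rewrite !inE tree_sym !xpair_eqE; do !case: eqP => //=. Qed.

Lemma connect_remove_edge_sym u v : connect_sym (edge_rel (remove_edge u v)).
Proof. by apply: sym_connect_sym => x y; apply: remove_edge_sym. Qed.

(** A simple path from [u] to [v] that avoids the edge would close up with it to a cycle. The bound
    of [tree_acyclic] leaves only a loop or the removed edge itself. *)
Lemma tree_cut_edge u v :
  (u, v) \in E -> ~~ connect (edge_rel (remove_edge u v)) u v.
Proof.
move=> uv; apply/negP => /connectP[p0 /shortenP[p up uniqp _] vE].
have sz : size p <= 1.
  apply: (@tree_acyclic u) => //; last by rewrite -vE tree_sym.
  by apply: sub_path up => x y; rewrite /edge_rel /= !inE => /and3P[].
case: p sz up vE {uniqp} => [|w [|//]] _ /= up vE.
  by have := tree_neq uv; rewrite vE eqxx.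
by move: up; rewrite vE /edge_rel /= !inE eqxx !andbF.
Qed.

(* Every edge of a simple path separates its two ends. *)
Lemma tree_path_edges (F : edges V) x p :
  F \subset E -> (forall a b, ((a, b) \in F) = ((b, a) \in F)) ->
  path (edge_rel E) x p -> uniq (x :: p) -> connect (edge_rel F) x (last x p) ->
  path (edge_rel F) x p.
Proof.
move=> sFE symF; elim: p x => //= v p IH x /andP[xv vp] /andP[xNvp uvp] cF.
have csymF : connect_sym (edge_rel F) by apply: sym_connect_sym => a b; apply: symF.
have xvF : (x, v) \in F.
  (* Without this edge in [F], going from [x] to the end inside [F] and back to [v] along the tail
     would join [x] and [v] while avoiding the edge. *)
  apply: contraT => xvF; have/negP[] := tree_cut_edge xv.
  apply: (@connect_trans _ _ (last v p)).
    apply: connect_sub cF => a b abF; apply: connect1; move: abF.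
    rewrite /edge_rel /= !inE => abF; rewrite (subsetP sFE _ abF) andbT.
    by apply/andP; split; apply: contraNneq xvF => -[<- <-] //; rewrite symF.
  rewrite connect_remove_edge_sym; apply/connectP; exists p => //.
  (* The tail does not visit [x], so it does not use the removed edge. *)
  apply: (@sub_in_path _ (predC1 x) _ _ _ _ _ _ vp).
    move=> a b; rewrite !inE /edge_rel /= => ax bx ab.
    by rewrite !inE ab !xpair_eqE (negbTE ax) (negbTE bx) andbF.
  by apply/allP => a avp; rewrite !inE; apply: contraNneq xNvp => <-.
rewrite {1}/edge_rel /= xvF IH //.
by apply: connect_trans cF; apply: connect1; rewrite /edge_rel /= symF.
Qed.

End Trees.

(** * Subtrees: intersection, pruning and branches *)

Section Subtrees.

Variables (V : finType) (E : edges V).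
Hypothesis treeE : is_tree [set: V] E.

Lemma induced_sub (F : edges V) (B : {set V}) : induced F B \subset F.
Proof. by apply/subsetP => e; rewrite inE => /andP[]. Qed.

Lemma induced_sym (F : edges V) (B : {set V}) :
  (forall a b, ((a, b) \in F) = ((b, a) \in F)) ->
  forall a b, ((a, b) \in induced F B) = ((b, a) \in induced F B).
Proof. by move=> symF a b; rewrite !inE /= symF (andbC (a \in B)). Qed.

Lemma connect_induced_sym (F : edges V) (B : {set V}) :
  (forall a b, ((a, b) \in F) = ((b, a) \in F)) ->
  connect_sym (edge_rel (induced F B)).
Proof. by move=> symF; apply: sym_connect_sym => a b; apply: induced_sym. Qed.

(** Simplicity and acyclicity are inherited from [E], so only connectedness has to be checked. *)
Lemma induced_tree (B : {set V}) :
  {in B &, forall x y, connect (edge_rel (induced E B)) x y} ->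
  is_tree B (induced E B).
Proof.
move=> cB; apply/and3P; split.
- apply/forallP => x; apply/forallP => y; apply/implyP.
  rewrite !inE /= => /and3P[xy -> ->].
  by rewrite (tree_neq treeE xy) -(tree_sym treeE) xy.
- by apply/forall_inP => x xB; apply/forall_inP => y yB; apply: cB.
- case/and3P: treeE => _ _ /forallP cP.
  apply/forallP => n; apply/forallP => c; apply/implyP => n2.
  move/forallP/(_ c)/implyP/(_ n2): (cP n); apply: contra => /andP[cc ->].
  rewrite andbT; apply: sub_cycle cc => x y.
  exact/subsetP/induced_sub.
Qed.

Lemma induced_setT : induced E [set: V] = E.
Proof. by apply/setP => e; rewrite !inE !andbT. Qed.

Section Subtree.

Variables (B : {set V}) (F : edges V).
Hypotheses (treeF : is_tree B F) (sFE : F \subset E).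

Lemma subtree_path x p : path (edge_rel E) x p -> uniq (x :: p) ->
  x \in B -> last x p \in B -> path (edge_rel F) x p.
Proof.
move=> xp uxp xB lB; apply: (tree_path_edges treeE) => //.
  exact: (tree_sym treeF).
exact: (tree_connect treeF).
Qed.

Lemma subtree_edge x y : x \in B -> y \in B -> (x, y) \in E -> (x, y) \in F.
Proof.
move=> xB yB xy; suff /andP[] : path (edge_rel F) x [:: y] by [].
apply: subtree_path => //=; first by rewrite andbT.
by rewrite inE andbT (tree_neq treeE xy).
Qed.

(** The simple path between two common nodes runs inside both subtrees. *)
Lemma subtree_setI (S : {set V}) :
  is_tree S (induced E S) -> is_tree (S :&: B) (induced E (S :&: B)).
Proof.
move=> treeS; apply: induced_tree => x y; rewrite !inE => /andP[xS xB] /andP[yS yB].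
have/connectP[p0 /shortenP[p xp uxp _] yE] := tree_connect treeS xS yS.
have xpE : path (edge_rel E) x p.
  by apply: sub_path xp => a b; apply/subsetP/induced_sub.
have xpF : path (edge_rel F) x p by apply: subtree_path => //; rewrite -yE.
apply/connectP; exists p => //; elim: p x {xS xB yE uxp xpE} xp xpF => //= a p IH x.
rewrite /edge_rel /= !inE /= => /andP[/and3P[-> -> ->] ap] /andP[xa aF].
by rewrite (tree_meml treeF xa) (tree_memr treeF xa) IH.
Qed.

End Subtree.

(** The part [K] of [S] is attached only at [i]. A path in [S] towards [i], stopped on reaching [i],
    cannot enter [K], since the edge used to enter would start at a node other than [i]. *)
Lemma prune_subtree (S K : {set V}) i :
  is_tree S (induced E S) -> i \in S :\: K ->
  (forall u v, u \in K -> v \in S :\: K -> (u, v) \in E -> v = i) ->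
  is_tree (S :\: K) (induced E (S :\: K)).
Proof.
move=> treeS; rewrite inE => /andP[iK iS] exitK.
have toi x : x \in S :\: K -> connect (edge_rel (induced E (S :\: K))) x i.
  rewrite inE => /andP[xK xS]; have/connectP[p xp iE] := tree_connect treeS xS iS.
  elim: p x xK xS xp iE => [|y p IH] x xK xS /=; first by move=> _ ->; apply: connect0.
  case/andP; rewrite /edge_rel /= inE /= => /and3P[xy _ yS] yp iE.
  have [->|xi] := eqVneq x i; first exact: connect0.
  have yK : y \notin K.
    apply: contraNN xi => yK; apply/eqP/(exitK y) => //; first by rewrite inE xK.
    by rewrite (tree_sym treeE).
  apply: connect_trans (IH y yK yS yp iE).
  by apply: connect1; rewrite /edge_rel /= !inE /= xy xS xK yS yK.
apply: induced_tree => x y xS yS; apply: connect_trans (toi x xS) _.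
by rewrite connect_induced_sym ?toi //; apply: tree_sym treeE.
Qed.

(** If [S] missed an end of the edge [iq], the walk [i], [c], [e], [d], [q] would avoid this edge:
    the stretches from [c] to [e] and from [d] to [q] avoid [i], and the one from [e] to [d] stays
    in [S]. This contradicts [tree_cut_edge]. *)
Lemma subtree_branches (S : {set V}) i q c d e :
  is_tree S (induced E S) -> (i, q) \in E -> (i, c) \in E -> q != c ->
  d \in S -> e \in S -> connect (edge_rel (induced E [set~ i])) q d ->
  connect (edge_rel (induced E [set~ i])) c e -> (i \in S) && (q \in S).
Proof.
move=> treeS iq ic qc dS eS qd ce; apply: contraT => iqS.
have/negP[] := tree_cut_edge treeE iq.
have off a b : connect (edge_rel (induced E [set~ i])) a b ->
    connect (edge_rel (remove_edge E i q)) a b.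
  apply: connect_sub => {}a {}b; rewrite /edge_rel /= !inE /= => /and3P[ab ai bi].
  by apply: connect1; rewrite /= !inE ab !xpair_eqE (negbTE ai) (negbTE bi) andbF.
apply: (@connect_trans _ _ c).
  apply: connect1; rewrite /edge_rel /= !inE ic !xpair_eqE [c == q]eq_sym (negbTE qc).
  by rewrite andbF eq_sym [c == i]eq_sym (negbTE (tree_neq treeE ic)) andbF.
apply: connect_trans (off _ _ ce) _; apply: (@connect_trans _ _ d); last first.
  by rewrite (connect_remove_edge_sym treeE) off.
apply: connect_sub (tree_connect treeS eS dS) => a b.
rewrite /edge_rel /= !inE /= => /and3P[ab aS bS]; apply: connect1.
rewrite /= !inE ab andbT !xpair_eqE; apply/andP; split.
  by apply: contra iqS => /andP[/eqP <- /eqP <-]; rewrite aS bS.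
by apply: contra iqS => /andP[/eqP <- /eqP <-]; rewrite aS bS.
Qed.

(** * The span of a node set in a tree *)

Section Span.

Variable D : {set V}.

(** The whole tree is a candidate, so a minimal one exists and the default [set0] in [span] is never
    taken. *)
Lemma span_minset :
  minset (fun B => is_tree B (induced E B) && (D \subset B)) (span E D).
Proof.
rewrite /span; case: pickP => //= noS.
have [S minS _] : {S | minset (fun B => is_tree B (induced E B) && (D \subset B)) S
                  & S \subset [set: V]}.
  by apply: minset_exists; rewrite induced_setT treeE subsetT.
by rewrite noS in minS.
Qed.

Lemma span_tree : is_tree (span E D) (induced E (span E D)).
Proof. by case/andP: (minsetp span_minset). Qed.

Lemma sub_span : D \subset span E D.
Proof. by case/andP: (minsetp span_minset). Qed.

Lemma span_min (B : {set V}) :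
  is_tree B (induced E B) -> D \subset B -> B \subset span E D -> B = span E D.
Proof. by move=> tB sDB sBS; apply: (minsetinf span_minset) => //; rewrite tB. Qed.

(** Intersecting the span with [B] gives a subtree that still contains [D]; minimality makes it the
    span itself. *)
Lemma span_sub_subtree (B : {set V}) (F : edges V) :
  is_tree B F -> F \subset E -> D \subset B -> span E D \subset B.
Proof.
move=> tB sFE sDB; suff <- : span E D :&: B = span E D by apply: subsetIr.
apply: span_min; last exact: subsetIl.
  exact: (subtree_setI tB sFE span_tree).
by rewrite subsetI sub_span.
Qed.

(** A branch of the span free of nodes of [D] could be pruned, against minimality. *)
Lemma span_branch (K : {set V}) i :
  i \in span E D :\: K -> span E D :&: K != set0 ->
  (forall u v, u \in K -> v \in span E D :\: K -> (u, v) \in E -> v = i) ->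
  K :&: D != set0.
Proof.
move=> iS SK exitK; apply: contraNneq SK => KD.
have <- : span E D :\: K = span E D.
  apply: span_min; last exact: subsetDl.
    exact: (prune_subtree span_tree iS exitK).
  by rewrite subsetD sub_span -setI_eq0 setIC KD eqxx.
by apply/eqP/setP => x; rewrite !inE; case: (x \in K); rewrite ?andbF.
Qed.

End Span.

End Subtrees.

(** * Essential arcs in orientations of a tree *)

Section Essential.

Variables (V : finType).
Implicit Types D E : edges V.

Lemma mem_parents D i j : (j \in parents D i) = ((j, i) \in D).
Proof. by rewrite inE. Qed.

Lemma mem_children D i j : (j \in children D i) = ((i, j) \in D).
Proof. by rewrite inE. Qed.

Lemma mem_components (B : {set V}) E x : x \in B ->
  [set y in B | connect (edge_rel (induced E B)) x y] \in components B E.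
Proof. by move=> xB; apply/imsetP; exists x. Qed.

Lemma mem_skeleton D x y :
  ((x, y) \in skeleton D) = ((x, y) \in D) || ((y, x) \in D).
Proof. by rewrite inE. Qed.

Lemma dag_asym D x y : is_dag D -> (x, y) \in D -> (y, x) \notin D.
Proof.
move=> /forallP/(_ x)/forallP/(_ y)/implyP dagD /dagD; apply: contra => yx.
exact: connect1.
Qed.

(** A directed cycle would be a cycle of the skeleton, so only pairs of opposite arcs have to be
    excluded. *)
Lemma tree_dag D : is_tree [set: V] (skeleton D) ->
  (forall x y, (x, y) \in D -> (y, x) \notin D) -> is_dag D.
Proof.
move=> treeD asym; apply/forallP => x; apply/forallP => y; apply/implyP => xy.
apply/negP => /connectP[p0 /shortenP[p yp uyp _] xE].
have sz : size p <= 1.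
  apply: (tree_acyclic treeD _ uyp); last by rewrite mem_skeleton -xE xy.
  by apply: sub_path yp => a b; rewrite /edge_rel /= mem_skeleton => ->.
case: p sz xE yp {uyp} => [|z [|//]] _ /= xE; last first.
  by rewrite andbT -xE => yx; have /negP := asym _ _ xy.
have : (x, y) \in skeleton D by rewrite mem_skeleton xy.
by move/(tree_neq treeD); rewrite xE eqxx.
Qed.

Variable D : edges V.
Hypotheses (treeD : is_tree [set: V] (skeleton D)) (dagD : is_dag D).

(** Two parents of a node are never adjacent, because a tree has no triangle. *)
Lemma v_structure_tree D' a b c : skeleton D' = skeleton D ->
  v_structure (pdag_of D') a b c = [&& (a, b) \in D', (c, b) \in D' & a != c].
Proof.
move=> skD'; rewrite /v_structure /= skD'.
have [ab|//] /= := boolP ((a, b) \in D'); have [cb|//] /= := boolP ((c, b) \in D').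
have [//|ac] /= := eqVneq a c; apply: (@tree_no_triangle _ _ _ treeD a b c) => //.
  by rewrite -skD' mem_skeleton ab.
by rewrite -skD' mem_skeleton cb orbT.
Qed.

Lemma markov_equivP D' :
  reflect (skeleton D' = skeleton D /\ forall a b c, a != c ->
             ((a, b) \in D) && ((c, b) \in D) = ((a, b) \in D') && ((c, b) \in D'))
          (markov_equiv (pdag_of D) (pdag_of D')).
Proof.
apply: (iffP andP) => /= -[].
  move=> /eqP skD vsD; split=> // a b c ac.
  move: vsD => /forallP/(_ a)/forallP/(_ b)/forallP/(_ c).
  by rewrite !v_structure_tree // ac !andbT => /eqP.
move=> skD vsD; split; first by rewrite skD.
apply/forallP => a; apply/forallP => b; apply/forallP => c.
rewrite !v_structure_tree //; have [_|ac] := eqVneq a c; first by rewrite !andbF.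
by rewrite !andbT vsD.
Qed.

Lemma essential_sub x y : (x, y) \in essential_arcs D -> (x, y) \in D.
Proof.
rewrite inE => /forallP/(_ D)/implyP; apply; rewrite dagD /=.
exact/markov_equivP.
Qed.

Lemma essential_collider a b c :
  (a, b) \in D -> (c, b) \in D -> a != c -> (a, b) \in essential_arcs D.
Proof.
move=> ab cb ac; rewrite inE; apply/forallP => D'.
apply/implyP => /andP[_ /markov_equivP[_ /(_ a b c ac)]].
by rewrite ab cb => /esym/andP[].
Qed.

Lemma v_structure_essential_graph a b c :
  v_structure (essential_graph D) a b c = [&& (a, b) \in D, (c, b) \in D & a != c].
Proof.
rewrite -(v_structure_tree a b c erefl) /v_structure /=.
apply/and4P/and4P => -[ab cb ac adj]; split=> //; try exact: essential_sub.
  exact: essential_collider ab cb ac.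
by apply: (essential_collider cb ab); rewrite eq_sym.
Qed.

(** Reversing [x -> y] in an equivalent DAG, where [w -> x] persists, would create the v-structure
    [w -> x <- y]. *)
Lemma essential_descend w x y :
  (w, x) \in essential_arcs D -> (x, y) \in D -> (x, y) \in essential_arcs D.
Proof.
move=> wx xy; have wxD := essential_sub wx.
rewrite inE; apply/forallP => D'; apply/implyP => DD'.
have wxD' : (w, x) \in D' by move: wx; rewrite inE => /forallP/(_ D')/implyP/(_ DD').
case/andP: DD' => _ /markov_equivP[skD' vsD'].
have : (x, y) \in skeleton D' by rewrite skD' mem_skeleton xy.
rewrite mem_skeleton => /orP[//|yx].
have wy : w != y.
  by apply: contraTneq wxD => ->; apply: dag_asym.
by have := vsD' _ x _ wy; rewrite wxD' yx (negbTE (dag_asym dagD xy)) andbF.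
Qed.

Lemma essential_parentsP x :
  reflect (exists w, (w, x) \in essential_arcs D) (essential_parents D x != set0).
Proof.
apply: (iffP (set0Pn _)) => -[w].
  by rewrite inE => /andP[_ wx]; exists w.
by move=> wx; exists w; rewrite !inE essential_sub //; move: wx; rewrite inE.
Qed.

Lemma essential_parents_collider a b c : (a, b) \in D -> (c, b) \in D -> a != c ->
  essential_parents D b != set0.
Proof.
by move=> ab cb ac; apply/essential_parentsP; exists a; apply: essential_collider ab cb ac.
Qed.

Lemma essential_parents_connect x y : connect (edge_rel D) x y ->
  essential_parents D x != set0 -> essential_parents D y != set0.
Proof.
case/connectP=> p; elim: p x => [|z p IH] x /=; first by move=> _ ->.
case/andP=> xz zp yE /essential_parentsP[w wx]; apply: (IH z) => //.
by apply/essential_parentsP; exists x; apply: essential_descend wx xz.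
Qed.

(** At most one parent; a node without parents qualifies. *)
Definition unique_parent x :=
  forall a b, (a, x) \in D -> (b, x) \in D -> a = b.

(** Walking backwards from [y] leaves no choice, so the ancestors of [y] form a chain. The induction
    strips the last arc, which two nontrivial paths to [y] must share. *)
Lemma ancestors_comparable u v y :
  (forall z, connect (edge_rel D) z y -> unique_parent z) ->
  connect (edge_rel D) u y -> connect (edge_rel D) v y ->
  connect (edge_rel D) u v || connect (edge_rel D) v u.
Proof.
move=> upar /connectP[p]; elim/last_ind: p y upar => [|p y' IH] y upar.
  by move=> _ /= -> ->; rewrite orbT.
rewrite last_rcons rcons_path => /andP[up py] yE; subst y'.
have [->|vy] := eqVneq v y.
  move=> _; apply/orP; left; apply: (@connect_trans _ _ (last u p)); last exact: connect1.
  by apply/connectP; exists p.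
case/connectP=> q; case/lastP: q => [_ /= yv|q y']; first by rewrite yv eqxx in vy.
rewrite last_rcons rcons_path => /andP[vq qy] yE; subst y'.
have E : last u p = last v q by apply: (upar y (connect0 _ _)).
apply: (IH (last u p)) => //; last by apply/connectP; exists q.
move=> z zu; apply: upar; apply: connect_trans zu _; exact: connect1.
Qed.

(** If [x] had no essential parent, reversing all arcs into ancestors of [y] would give a Markov
    equivalent DAG without [x -> y]. *)
Lemma essential_unique_parent x y :
  (x, y) \in essential_arcs D -> unique_parent y -> essential_parents D x != set0.
Proof.
move=> xyess upy; apply: contraTT (xyess) => nx.
have xy := essential_sub xyess.
pose A := [set z | connect (edge_rel D) z y].
(* Any ancestor [z] other than [y] reaches [y] through [x], so two parents of [z] would pass an
   essential parent down to [x]. *)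
have upA z : z \in A -> unique_parent z.
  rewrite inE; have [-> //|zy] := eqVneq z y.
  case/connectP=> p; case/lastP: p => [_ /= yv|p y']; first by rewrite yv eqxx in zy.
  rewrite last_rcons rcons_path => /andP[zp py] yE a b az bz; subst y'.
  have E := upy _ _ py xy.
  apply: contraNeq nx => ab; apply: (@essential_parents_connect z).
    by apply/connectP; exists p.
  exact: essential_parents_collider az bz ab.
have downA u v : (u, v) \in D -> v \in A -> u \in A.
  by rewrite !inE => uv; apply: connect_trans; apply: connect1.
(* As [A] is closed under ancestors, the arcs with head in [A] are those inside [A]. These are
   reversed, and nodes outside [A] keep their parents. *)
pose D' : edges V := [set e | if e.2 \in A then ((e.2, e.1) \in D) && (e.1 \in A)
                              else e \in D].
have D'P u v : ((u, v) \in D') =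
    if v \in A then ((v, u) \in D) && (u \in A) else (u, v) \in D by rewrite inE.
have skD' : skeleton D' = skeleton D.
  apply/setP => -[u v]; rewrite !mem_skeleton !D'P.
  have := @downA u v; have := @downA v u.
  case: (u \in A); case: (v \in A); case: ((u, v) \in D); case: ((v, u) \in D) => //= d1 d2;
    by [have := d1 isT isT | have := d2 isT isT].
have dagD' : is_dag D'.
  apply: tree_dag; first by rewrite skD'.
  move=> u v; rewrite !D'P.
  have := @downA u v; have := @downA v u; have := @dag_asym D u v dagD.
  case: (u \in A); case: (v \in A); case: ((u, v) \in D); case: ((v, u) \in D) => //= d0 d1 d2;
    by [have := d0 isT | have := d1 isT isT | have := d2 isT isT].
rewrite inE; apply/negP => /forallP/(_ D')/implyP.
have yA : y \in A by rewrite inE.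
rewrite D'P yA (negbTE (dag_asym dagD xy)) dagD' => H.
(* Only heads [b] in [A] matter. Such a node has at most one parent in [D], so it must be shown that
   it gets no two parents in [D'], that is, has no two children in [A]. *)
suff: false by []; apply: H; apply/markov_equivP; split=> // a b c ac.
rewrite !D'P; case: ifP => bA //.
have -> : ((a, b) \in D) && ((c, b) \in D) = false.
  by apply: contra_neqF ac => /andP[]; apply: upA.
apply/esym/negP => /andP[/andP[ba aA] /andP[bc cA]].
(* Two children of b above y are comparable, and then b is its own ancestor. *)
have noac u v : (b, u) \in D -> (b, v) \in D -> v \in A ->
    connect (edge_rel D) u v -> u = v.
  move=> bu bv vA /connectP[p]; case/lastP: p => [//|p w].
  rewrite last_rcons rcons_path => /andP[up pv] vE; subst w.
  have lb : last u p = b by apply: (upA v).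
  move: dagD => /forallP/(_ b)/forallP/(_ u)/implyP/(_ bu)/negP[].
  by apply/connectP; exists p.
move: (aA) (cA); rewrite !inE => ay cy.
have upA' z : connect (edge_rel D) z y -> unique_parent z.
  by move=> zy; apply: upA; rewrite inE.
case/orP: (ancestors_comparable upA' ay cy) => /noac.
  by move=> /(_ ba bc cA) /eqP; apply/negP.
by move=> /(_ bc ba aA) /esym/eqP; apply/negP.
Qed.
End Essential.

(** * Delta in terms of v-structures *)

Section Differences.

Variable V : finType.
Implicit Types (E G H D : edges V).

(** Only [i] can be the common child in [S]: if it were another node [j], a third node of [S] would
    form a triangle with [i] and [j]. *)
Lemma char_imset_star E D i (S : imset_index V) :
  is_tree [set: V] E -> skeleton D = E -> S \in star_sets E i ->
  char_imset D S = (val S :\ i \subset parents D i).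
Proof.
move=> treeE skD; rewrite !inE => /and3P[iS Sne S3]; rewrite ffunE.
have ne j : j \in val S -> j != i -> (i, j) \in E.
  by move=> /(subsetP Sne); rewrite !inE => /orP[->|].
suff -> : [exists j in val S, val S :\ j \subset parents D j] = (val S :\ i \subset parents D i).
  by case: ifP.
apply/exists_inP/idP => [[j jS jpa]|]; last by exists i.
have [<- //|ji] := eqVneq j i.
have /card_gt0P[k] : 0 < #|val S :\ i :\ j|.
  by move: S3; rewrite (cardsD1 i) iS (cardsD1 j) !inE ji jS.
rewrite !inE => /and3P[kj ki kS].
have := subsetP jpa k; rewrite !inE kj kS => /(_ isT) kjD.
have jiE : (j, i) \in E by rewrite (tree_sym treeE) ne.
suff /negP[] : (j, k) \notin E by rewrite -skD mem_skeleton kjD orbT.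
by apply: (tree_no_triangle treeE jiE (ne k kS ki)); rewrite eq_sym.
Qed.

(** Sets of three nodes suffice: when [S] distinguishes the imsets, a node [a] that is a parent in
    only one of the DAGs, with any further node of [S], gives a v-structure at [i] in that DAG
    only. *)
Lemma DeltaP E G H i :
  is_tree [set: V] E -> skeleton G = E -> skeleton H = E ->
  reflect (exists a b, a != b /\ ((a, i) \in G) && ((b, i) \in G)
                                != ((a, i) \in H) && ((b, i) \in H))
          (i \in Delta E (char_imset G) (char_imset H)).
Proof.
move=> treeE skG skH; rewrite inE.
apply: (iffP existsP) => [[S /andP[SE]]|[a [b [ab abGH]]]].
  rewrite !(char_imset_star treeE _ SE) //.
  move: SE; rewrite !inE => /and3P[iS Sne S3].
  have pair D D' : val S :\ i \subset parents D i -> ~~ (val S :\ i \subset parents D' i) ->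
      exists a b, a != b /\ ((a, i) \in D) && ((b, i) \in D)
                                != ((a, i) \in D') && ((b, i) \in D').
    move=> SD /subsetPn[a aS aD'].
    have /card_gt0P[b] : 0 < #|val S :\ i :\ a|.
      by move: S3; rewrite (cardsD1 i) iS (cardsD1 a) aS.
    rewrite in_setD1 => /andP[ba bS]; exists a, b; rewrite eq_sym ba; split=> //.
    move: (subsetP SD a aS) (subsetP SD b bS) aD'; rewrite !inE => -> ->.
    by case: ((a, i) \in D').
  case SG: (_ \subset _); case SH: (_ \subset _) => // _.
    by apply: pair; rewrite ?SG ?SH.
  have [a [b [ab abHG]]] := pair H G SH (negbT SG).
  by exists a, b; rewrite eq_sym in abHG.
(* The pair consists of parents of [i] in one of the two DAGs, so [a] and [b] are neighbours of [i]
   and the triple is a star set. *)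
have [aE bE] : (i, a) \in E /\ (i, b) \in E.
  have sub D : skeleton D = E -> ((a, i) \in D) && ((b, i) \in D) ->
      (i, a) \in E /\ (i, b) \in E.
    by move=> <- /andP[aD bD]; rewrite !mem_skeleton aD bD !orbT.
  case GE: (((a, i) \in G) && _) abGH; first by move=> _; apply: (sub G).
  by case HE: (((a, i) \in H) && _) => // _; apply: (sub H).
have ia := tree_neq treeE aE; have ib := tree_neq treeE bE.
pose S := i |: [set a; b].
have S3 : #|S| = 3 by rewrite cardsU1 !inE negb_or ia ib cards2 ab.
have S2 : 1 < #|S| by rewrite S3.
pose S' : imset_index V := exist _ S S2.
have SE : S' \in star_sets E i.
  by rewrite inE /= S3 setU11 andbT setUS //; apply/subsetP => x /set2P[]->; rewrite inE.
exists S'; rewrite SE !(char_imset_star treeE _ SE) //=.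
have -> : S :\ i = [set a; b].
  by rewrite /S setU1K // !inE negb_or ia ib.
by rewrite !subUset !sub1set !inE; move: abGH; do 2!case: (_ && _).
Qed.

Lemma essential_graph_collider G D a b i : is_tree [set: V] (skeleton G) ->
  is_dag G -> is_dag D -> essential_graph D = essential_graph G -> a != b ->
  ((a, i) \in D) && ((b, i) \in D) = ((a, i) \in G) && ((b, i) \in G).
Proof.
move=> treeG dagG dagD [skDG essDG] ab.
have treeD : is_tree [set: V] (skeleton D) by rewrite skDG.
have ba : b != a by rewrite eq_sym.
apply/andP/andP => -[ai bi].
  by split; apply: (essential_sub treeG dagG); rewrite -essDG;
    [apply: (essential_collider treeD ai bi ab) | apply: (essential_collider treeD bi ai ba)].
by split; apply: (essential_sub treeD dagD); rewrite essDG;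
  [apply: (essential_collider treeG ai bi ab) | apply: (essential_collider treeG bi ai ba)].
Qed.

(** The representatives picked by [ess_imset] may differ from [G] and [H], but an essential graph
    determines the v-structures, on which alone Delta depends. *)
Lemma Delta_ess_imset E G H : is_tree [set: V] E -> skeleton G = E -> skeleton H = E ->
  is_dag G -> is_dag H ->
  Delta E (ess_imset (essential_graph G)) (ess_imset (essential_graph H)) =
  Delta E (char_imset G) (char_imset H).
Proof.
move=> treeE skG skH dagG dagH.
have rep D : is_dag D -> exists2 D', is_dag D' /\ essential_graph D' = essential_graph D &
    ess_imset (essential_graph D) = char_imset D'.
  move=> dagD; rewrite /ess_imset; case: pickP => [D' /andP[dagD' /eqP essD']|/(_ D)] /=.
    by exists D'.
  by rewrite dagD eqxx.
have [G' [dagG' eG'] ->] := rep G dagG; have [H' [dagH' eH'] ->] := rep H dagH.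
have skG' : skeleton G' = E by case: eG' => ->.
have skH' : skeleton H' = E by case: eH' => ->.
have treeG : is_tree [set: V] (skeleton G) by rewrite skG.
have treeH : is_tree [set: V] (skeleton H) by rewrite skH.
apply/setP => i.
apply/(DeltaP _ treeE skG' skH')/(DeltaP _ treeE skG skH) => -[a [b [ab abP]]];
  exists a, b; move: abP; rewrite (essential_graph_collider i treeG dagG dagG' eG' ab);
  rewrite (essential_graph_collider i treeH dagH dagH' eH' ab) => abP;
  by split.
Qed.

Lemma DeltaC E G H :
  Delta E (char_imset G) (char_imset H) = Delta E (char_imset H) (char_imset G).
Proof. by apply/setP => i; rewrite !inE; apply: eq_existsb => S; rewrite eq_sym. Qed.

Lemma mem_diff_edges G H x y : ((x, y) \in diff_edges G H) =
  ((x, y) \in G) && ((y, x) \in H) || ((y, x) \in G) && ((x, y) \in H).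
Proof. by rewrite inE. Qed.

Lemma diff_edgesC G H : diff_edges G H = diff_edges H G.
Proof. by apply/setP => -[x y]; rewrite !mem_diff_edges orbC andbC (andbC ((x, y) \in G)). Qed.

Lemma diff_nodesC G H : diff_nodes G H = diff_nodes H G.
Proof. by apply/setP => x; rewrite !inE diff_edgesC. Qed.

End Differences.

(** The standing hypotheses, bundled so that every result can be reused with [G] and [H]
    exchanged. *)
Definition differ_on_subtree (V : finType) (E G H : edges V) :=
  [/\ is_dag G, is_dag H, skeleton G = E, skeleton H = E &
   is_tree [set: V] E /\ is_tree (diff_nodes G H) (diff_edges G H)].

(** * Passing from G to H: reversal inside T, no change elsewhere *)

Section Reversal.

Variables (V : finType) (E G H : edges V).

Local Notation T := (diff_nodes G H).
Local Notation ET := (diff_edges G H).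
Local Notation Dl := (Delta E (char_imset G) (char_imset H)).
Local Notation S := (span E Dl).

Hypothesis GH : differ_on_subtree E G H.

Let dagG : is_dag G. Proof. by case: GH. Qed.
Let dagH : is_dag H. Proof. by case: GH. Qed.
Let skG : skeleton G = E. Proof. by case: GH. Qed.
Let skH : skeleton H = E. Proof. by case: GH. Qed.
Let treeE : is_tree [set: V] E. Proof. by case: GH => _ _ _ _ []. Qed.
Let treeT : is_tree T ET. Proof. by case: GH => _ _ _ _ []. Qed.

Lemma mem_skeletonG x y : ((x, y) \in E) = ((x, y) \in G) || ((y, x) \in G).
Proof. by rewrite -skG mem_skeleton. Qed.

Lemma mem_skeletonH x y : ((x, y) \in E) = ((x, y) \in H) || ((y, x) \in H).
Proof. by rewrite -skH mem_skeleton. Qed.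

Lemma diff_edges_sub : ET \subset E.
Proof.
apply/subsetP => -[x y]; rewrite mem_diff_edges mem_skeletonG.
by case/orP=> /andP[-> _]; rewrite ?orbT.
Qed.

(** A subtree contains every edge of [E] between two of its nodes, so all arcs inside T are
    reversed. *)
Lemma edge_reversed x y : x \in T -> y \in T -> (x, y) \in G -> (y, x) \in H.
Proof.
move=> xT yT xy; have : (x, y) \in ET.
  by apply: (subtree_edge treeE treeT diff_edges_sub xT yT); rewrite mem_skeletonG xy.
by rewrite mem_diff_edges xy (negbTE (dag_asym dagG xy)) orbF.
Qed.

Lemma edge_kept x y : (x, y) \in G -> (x \notin T) || (y \notin T) -> (x, y) \in H.
Proof.
move=> xy; apply: contraTT => xyH.
have yx : (y, x) \in H.
  have : (x, y) \in E by rewrite mem_skeletonG xy.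
  by rewrite mem_skeletonH (negbTE xyH).
by rewrite -negb_and negbK !inE; apply/andP; split; apply/existsP;
  [exists y | exists x]; rewrite mem_diff_edges xy yx ?orbT.
Qed.

Lemma collider_in_Delta a b i : (a, i) \in G -> (b, i) \in G -> a != b ->
  (a, i) \notin H -> i \in Dl.
Proof.
move=> ai bi ab aiH; apply/(DeltaP _ treeE skG skH).
by exists a, b; rewrite ai bi (negbTE aiH).
Qed.

Lemma Delta_collider i : i \in Dl -> unique_parent G i ->
  exists a b, [/\ a != b, (a, i) \in H & (b, i) \in H].
Proof.
case/(DeltaP _ treeE skG skH) => a [b [ab abP]] upG; exists a, b.
have /negbTE abG : ~~ (((a, i) \in G) && ((b, i) \in G)).
  by apply: contraNN ab => /andP[aG bG]; rewrite (upG a b).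
by move: abP; rewrite abG; case/boolP: (_ && _) => // /andP[-> ->].
Qed.

(** Suppose [i] had two parents in [G], and let [iy] be an edge of T. If [y -> i] in [G], then [y]
    and another parent form a v-structure lost in [H]. If [i -> y], either a parent [a] is lost, or
    [a] and [y] form a new v-structure in [H]. *)
Lemma not_Delta_unique_parent i : i \in T -> i \notin Dl -> unique_parent G i.
Proof.
rewrite inE => /existsP[y]; rewrite mem_diff_edges => iy iD a b ai bi.
apply: contraNeq iD => ab.
case/orP: iy => /andP[iy yi].
  apply/(DeltaP _ treeE skG skH).
  have ay : a != y by apply: contraTneq ai => ->; apply: dag_asym iy.
  case aiH : ((a, i) \in H); last by exists a, b; rewrite ai bi aiH.
  by exists a, y; rewrite ai aiH yi (negbTE (dag_asym dagG iy)).
have /negbTE yiH := dag_asym dagH yi.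
have [ay|ay] := eqVneq a y.
  by apply: (collider_in_Delta ai bi ab); rewrite ay yiH.
by apply: (collider_in_Delta iy ai); rewrite ?yiH // eq_sym.
Qed.

Lemma Delta_sub : Dl \subset T.
Proof.
apply/subsetP => i /(DeltaP _ treeE skG skH)[a [b [_]]].
apply: contraNT => iT.
have eqGH x : ((x, i) \in G) = ((x, i) \in H).
  apply/idP/idP => [xi|xi]; first by apply: edge_kept => //; rewrite iT orbT.
  have : (x, i) \in E by rewrite mem_skeletonH xi.
  rewrite mem_skeletonG => /orP[// | ix]; have := edge_kept ix; rewrite iT => /(_ isT) ixH.
  by have := dag_asym dagH ixH; rewrite xi.
by rewrite !eqGH.
Qed.

Lemma span_sub : S \subset T.
Proof. exact: (span_sub_subtree treeE treeT diff_edges_sub Delta_sub). Qed.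

Lemma parents_out j i : j \notin T -> (j, i) \in H -> (j, i) \in G.
Proof.
move=> jT ji; have : (j, i) \in E by rewrite mem_skeletonH ji.
rewrite mem_skeletonG => /orP[//|ij].
have := edge_kept ij; rewrite jT orbT => /(_ isT) ijH.
by have := dag_asym dagH ji; rewrite ijH.
Qed.

Lemma children_in j i : i \in T -> j \in T -> (j, i) \in H -> (i, j) \in G.
Proof.
move=> iT jT ji; have : (j, i) \in E by rewrite mem_skeletonH ji.
rewrite mem_skeletonG => /orP[jiG|//].
by have := dag_asym dagH ji; rewrite edge_reversed.
Qed.

Lemma parents_outE i : parents H i :\: T = parents G i :\: T.
Proof.
apply/setP => j; rewrite !in_setD; case jT: (j \in T) => //=.
rewrite !mem_parents; apply/idP/idP; first by apply: parents_out; rewrite jT.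
by move=> ji; apply: edge_kept; rewrite ?jT.
Qed.

(** Together with [parents_outE], this describes the parents of a node of T in [H] through [G], and
    so translates the conditions when the DAGs are exchanged. *)
Lemma parents_inE i : i \in T -> T :&: parents H i = T :&: children G i.
Proof.
move=> iT; apply/setP => j; rewrite !in_setI; case jT: (j \in T) => //=.
rewrite mem_parents mem_children; apply/idP/idP; first exact: children_in.
exact: edge_reversed.
Qed.

End Reversal.

Lemma differ_on_subtreeC (V : finType) (E G H : edges V) :
  differ_on_subtree E G H -> differ_on_subtree E H G.
Proof. by case=> ? ? ? ? [? ?]; split; rewrite // diff_nodesC diff_edgesC. Qed.

Definition flip_conds (V : finType) (E G H : edges V) i :=
  [/\ cond_IV G H (diff_nodes G H) i, cond_V G H (diff_nodes G H) i
    & cond_VI G H (diff_nodes G H) (diff_edges G H)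
        (Delta E (char_imset G) (char_imset H)) i].

(** * Consequences of the conditions at nodes of the span *)

Section ConditionsToEssential.

Variables (V : finType) (E G H : edges V).

Local Notation T := (diff_nodes G H).
Local Notation ET := (diff_edges G H).
Local Notation Dl := (Delta E (char_imset G) (char_imset H)).
Local Notation S := (span E Dl).

Hypothesis GH : differ_on_subtree E G H.

Let dagG : is_dag G. Proof. by case: GH. Qed.
Let skG : skeleton G = E. Proof. by case: GH. Qed.
Let treeE : is_tree [set: V] E. Proof. by case: GH => _ _ _ _ []. Qed.
Let treeT : is_tree T ET. Proof. by case: GH => _ _ _ _ []. Qed.
Let HG := differ_on_subtreeC GH.

Lemma span_diff_node x : x \in S -> x \in T.
Proof. exact/subsetP/(span_sub GH). Qed.

(** Exchanging the DAGs swaps parents and children within T. Hence IV and V trade places, and VI is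
    symmetric. *)
Lemma flip_condsC i : i \in T -> flip_conds E G H i -> flip_conds E H G i.
Proof.
move=> iT [c4 c5 c6].
have paH := parents_inE GH iT.
have chH : T :&: children H i = T :&: parents G i.
  have := parents_inE HG.
  by rewrite diff_nodesC => /(_ i iT) ->.
have out := parents_outE GH i.
rewrite /flip_conds (diff_nodesC H G) (diff_edgesC H G) (DeltaC E H G).
split; rewrite /cond_IV /cond_V /cond_VI paH chH out.
- by move=> ch2 q Tpa; apply: c5.
- by move=> c Tch pa2; apply: c4.
- move=> q c Tq Tc /(c6 c q Tc Tq)[|[eH eG]]; first by left.
  by right.
Qed.

(** Each component of T without [i] is attached to [i] through [q] or [c], hence meets the span.
    Were it free of Delta, it could be pruned. *)
Lemma span_components i q c : i \in S -> q \in S -> c \in S ->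
  T :&: parents G i = [set q] -> T :&: children G i = [set c] ->
  forall K, K \in components (T :\ i) ET -> K :&: Dl != set0.
Proof.
move=> iS qS cS Tq Tc K /imsetP[x]; rewrite in_setD1 => /andP[xi xT] ->.
set R := edge_rel _.
have iT := span_diff_node iS.
(* Here [n] is the node just before [i] is first reached on a path from [x] in T. *)
have [n [ni nET xn]] : exists n, [/\ n != i, (n, i) \in ET & connect R x n].
  have /connectP[p] := tree_connect treeT xT iT.
  elim: p x xi xT => [|y p IH] x xi xT /=; first by move=> _ iE; rewrite iE eqxx in xi.
  case/andP=> xy yp iE; have yT := tree_memr treeT xy.
  have [yi|yi] := eqVneq y i; first by exists x; rewrite -{2}yi.
  have [n [ni nET yn]] := IH y yi yT yp iE; exists n; split=> //.
  apply: connect_trans yn; apply: connect1.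
  rewrite /R /edge_rel /= [_ \in induced _ _]inE /= !in_setD1 xi xT yi yT !andbT.
  exact: xy.
have nT := tree_meml treeT nET.
have nS : n \in S.
  move: nET; rewrite mem_diff_edges => /orP[]/andP[nG _].
    have : n \in [set q] by rewrite -Tq in_setI nT mem_parents.
    by move/set1P->.
  have : n \in [set c] by rewrite -Tc in_setI nT mem_children.
  by move/set1P->.
apply: (span_branch treeE (i := i)).
- by rewrite in_setD iS andbT in_set in_setD1 eqxx.
- by apply/set0Pn; exists n; rewrite in_setI nS in_set in_setD1 ni nT.
move=> u v; rewrite [in X in X -> _]in_set in_setD1 => /andP[/andP[ui uT] xu].
rewrite in_setD => /andP[vK vS] uv; apply: contraNeq vK => vi.
have vT := span_diff_node vS.
rewrite in_set in_setD1 vi vT /=; apply: connect_trans xu _; apply: connect1.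
rewrite /R /edge_rel /= [_ \in induced _ _]inE /= !in_setD1 ui uT vi vT !andbT.
exact: (subtree_edge treeE treeT (diff_edges_sub GH) uT vT uv).
Qed.

(** Certifies that [i] is internal in T, so that the conditions may be invoked there. *)
Lemma diff_degree i q c : q \in T -> i \in T -> c \in T ->
  (q, i) \in G -> (i, c) \in G -> 2 <= #|[set j | (i, j) \in ET]|.
Proof.
move=> qT iT cT qi ic.
have qc : q != c by apply: contraTneq qi => ->; apply: dag_asym ic.
have <- : #|[set q; c]| = 2 by rewrite cards2 qc.
have rev := edge_reversed GH.
apply/subset_leq_card/subsetP => j; rewrite in_set mem_diff_edges => /set2P[]->.
  by rewrite qi (rev q i) ?orbT.
by rewrite ic (rev i c).
Qed.

(** Outside Delta, [a] has at most one parent in each DAG, so it has type VI with Delta on both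
    sides once it has a parent [q] in the span. *)
Lemma not_Delta_chain a b :
  (forall i, 2 <= #|[set j | (i, j) \in ET]| -> flip_conds E G H i) ->
  a \in S -> b \in S -> (a, b) \in G -> a \notin Dl ->
  exists q, [/\ (q, a) \in G, essential_parents G q != set0
              & essential_parents H b != set0].
Proof.
move=> conds aS bS ab aD.
have aT := span_diff_node aS; have bT := span_diff_node bS.
have upG := not_Delta_unique_parent GH aT aD.
have upH : unique_parent H a.
  by apply: (not_Delta_unique_parent HG); rewrite 1?diff_nodesC 1?DeltaC.
have rev := edge_reversed GH.
have baH := rev a b aT bT ab.
have [/exists_inP[q qS qa]|noq] := boolP [exists q in S, (q, a) \in G]; last first.
  (* Without such a [q], the node [a] would be a leaf of the span attached to [b]; being outside
     Delta, it could be pruned. *)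
  have := span_branch (i := b) (K := [set a]) treeE (D := Dl).
  case/(_ _ _ _)/set0Pn.
  - by rewrite in_setD bS in_set1 andbT eq_sym (tree_neq treeE) // -skG mem_skeleton ab.
  - by apply/set0Pn; exists a; rewrite in_setI aS set11.
  - move=> u v /set1P -> /setDP[vS _]; rewrite -skG mem_skeleton => /orP[av|va].
      exact: upH _ _ (rev a v aT (span_diff_node vS) av) baH.
    by case/exists_inP: noq; exists v.
  by move=> x /setIP[/set1P->]; rewrite (negbTE aD).
have qT := span_diff_node qS.
have Tq : T :&: parents G a = [set q].
  apply/setP => x; rewrite in_setI mem_parents in_set1; apply/andP/eqP => [[_ xa]|->].
    exact: upG _ _ xa qa.
  by [].
have Tb : T :&: children G a = [set b].
  apply/setP => x; rewrite in_setI mem_children in_set1; apply/andP/eqP => [[xT ax]|->].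
    exact: upH _ _ (rev a x aT xT ax) baH.
  by [].
have [_ _ c6] := conds a (diff_degree qT aT bT qa ab).
have [|[/set0Pn eH /set0Pn eG]] := c6 q b Tq Tb (span_components aS qS bS Tq Tb); last by exists q.
(* A parent outside T would have to be [q], which lies in T. *)
case/card_gt0P=> e /setDP[]; rewrite mem_parents => ea.
by rewrite (upG e q ea qa) qT.
Qed.

End ConditionsToEssential.

(** * The flip as essentiality of all arcs in the span *)

Section Characterization.

Variables (V : finType) (E G H : edges V).

Local Notation T := (diff_nodes G H).
Local Notation ET := (diff_edges G H).
Local Notation Dl := (Delta E (char_imset G) (char_imset H)).
Local Notation S := (span E Dl).

Hypothesis GH : differ_on_subtree E G H.

Let dagG : is_dag G. Proof. by case: GH. Qed.
Let dagH : is_dag H. Proof. by case: GH. Qed.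
Let skG : skeleton G = E. Proof. by case: GH. Qed.
Let skH : skeleton H = E. Proof. by case: GH. Qed.
Let treeE : is_tree [set: V] E. Proof. by case: GH => _ _ _ _ []. Qed.
Let treeT : is_tree T ET. Proof. by case: GH => _ _ _ _ []. Qed.
Let treeG : is_tree [set: V] (skeleton G). Proof. by rewrite skG. Qed.
Let treeH : is_tree [set: V] (skeleton H). Proof. by rewrite skH. Qed.
Let HG := differ_on_subtreeC GH.

Let SC : span E (Delta E (char_imset H) (char_imset G)) = S.
Proof. by rewrite DeltaC. Qed.

Lemma flip_conds_essential a b :
  (forall i, 2 <= #|[set j | (i, j) \in ET]| -> flip_conds E G H i) ->
  a \in S -> b \in S -> (a, b) \in G -> (a, b) \in essential_arcs G.
Proof.
move=> conds aS bS ab.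
have aT := span_diff_node GH aS.
have bT := span_diff_node GH bS.
have rev := edge_reversed GH.
have baH := rev a b aT bT ab.
have [/existsP[a' /andP[a'b aa']]|noa'] := boolP [exists a', ((a', b) \in G) && (a != a')].
  exact: (essential_collider treeG ab a'b aa').
have paB x : (x, b) \in G -> x = a.
  by move=> xb; apply: contraNeq noa' => xa; apply/existsP; exists x; rewrite xb eq_sym.
have upG : unique_parent G b by move=> x y /paB -> /paB ->.
suff /(essential_parentsP treeG dagG)[w wa] : essential_parents G a != set0.
  exact: essential_descend wa ab.
have [aD|aD] := boolP (a \in Dl); last first.
  have [q [qa eq _]] := not_Delta_chain GH conds aS bS ab aD.
  exact: (essential_parents_connect treeG dagG (connect1 qa) eq).
have [bD|bD] := boolP (b \in Dl); last first.
  (* With the DAGs exchanged, the chain runs along [b -> a] in [H], and its last conclusion gives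
     [a] an essential parent in [G]. *)
  have [|||||q [_ _ //]] := @not_Delta_chain V E H G HG b a.
  - move=> i; rewrite diff_edgesC => i2.
    apply: (flip_condsC GH) (conds i i2).
    case/card_gt0P: (ltnW i2) => j; rewrite in_set; exact: (tree_meml treeT).
  - by rewrite SC.
  - by rewrite SC.
  - exact: baH.
  - by rewrite DeltaC.
(* The v-structure that puts [b] in Delta lies in [H]. Its tails are in T, since a parent of [b]
   outside T would be a parent in [G] too; so [b] has type V with T-parent [a]. *)
have [u [v [uv ub vb]]] := Delta_collider GH bD upG.
have inT x : (x, b) \in H -> x \in T :&: children G b.
  move=> xb; rewrite -(parents_inE GH bT) in_setI mem_parents xb andbT.
  apply: contraT => xT; have xG := parents_out GH xT xb.
  by rewrite (paB x xG) aT in xT.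
have Tch2 : 2 <= #|T :&: children G b|.
  have <- : #|[set u; v]| = 2 by rewrite cards2 uv.
  by apply/subset_leq_card/subsetP => x /set2P[]->; apply: inT.
have Tpa : T :&: parents G b = [set a].
  apply/setP => x; rewrite in_setI mem_parents in_set1; apply/andP/eqP => [[_ /paB //]|->].
  by split; [exact: aT | exact: ab].
have [uT ubG] : u \in T /\ (b, u) \in G by have := inT u ub; rewrite in_setI mem_children => /andP.
have [_ c5 _] := conds b (diff_degree GH aT bT uT ab ubG).
have [|vs] := c5 a Tpa Tch2.
  by case/card_gt0P=> x /setDP[]; rewrite mem_parents => /paB ->; rewrite aT.
have [/existsP[x /existsP[y /and3P[xa ya xy]]]|noup] :=
    boolP [exists x, exists y, [&& (x, a) \in G, (y, a) \in G & x != y]].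
  exact: (essential_parents_collider treeG dagG xa ya xy).
have upA : unique_parent G a.
  move=> x y xa ya; apply: contraNeq noup => xy.
  by apply/existsP; exists x; apply/existsP; exists y; rewrite xa ya.
(* With at most one parent in [G], the node [a] of Delta has a v-structure in [H], which triggers
   the implication of condition V. *)
have [x [y [xy xa ya]]] := Delta_collider GH aD upA.
apply/set0Pn/vs; apply/existsP; exists x; apply/existsP; exists y.
by rewrite (v_structure_tree treeH x a y erefl) xa ya.
Qed.

(** The parents of [i] in [H] are its T-children in [G] and its parents outside T; only [c]
    remains. *)
Lemma reversed_unique_parent i c : i \in T -> T :&: children G i = [set c] ->
  #|parents G i :\: T| = 0 -> unique_parent H i.
Proof.
move=> iT Tc /eqP; rewrite cards_eq0 -(parents_outE GH) => /eqP out.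
suff eqc x : (x, i) \in H -> x = c by move=> x y /eqc -> /eqc ->.
move=> xi; apply/set1P; rewrite -Tc -(parents_inE GH iT) in_setI mem_parents xi andbT.
by apply: contraT => xT; rewrite -(in_set0 x) -out in_setD xT mem_parents.
Qed.

(** Both [i] and [c] are in Delta, so [c -> i] is essential in [H]. If [i] has no parent outside T,
    then [c] is its only parent in [H] and must itself have an essential parent. *)
Lemma flip_cond_IV i : i \in T ->
  (forall a b, a \in S -> b \in S -> (a, b) \in H -> (a, b) \in essential_arcs H) ->
  cond_IV G H T i.
Proof.
move=> iT essH pa2 c Tc.
case/card_gt1P: (pa2) => u [v [uP vP uv]].
move: uP vP; rewrite !in_setI !mem_parents => /andP[uT ui] /andP[vT vi].
have /andP[cT ic] : (c \in T) && ((i, c) \in G).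
  by have : c \in [set c] := set11 c; rewrite -Tc in_setI mem_children.
have rev := edge_reversed GH.
have ciH := rev i c iT cT ic.
have [out|out] := posnP #|parents G i :\: T|; last by left.
right => /existsP[x /existsP[y]]; rewrite (v_structure_tree treeG x c y erefl) => /and3P[xc yc xy].
have iD : i \in Dl.
  by apply: (collider_in_Delta GH ui vi uv); apply: (dag_asym dagH); apply: rev.
have cD : c \in Dl.
  have icH : (i, c) \notin H by apply: (dag_asym dagH).
  (* The v-structure at [c] need not involve [i]; if [i] is not [x], pairing [i] with [x] gives one
     that does. *)
  have [ix|ix] := eqVneq i x.
    by apply: (collider_in_Delta GH xc yc xy); rewrite -ix.
  exact: (collider_in_Delta GH ic xc ix icH).
have sD := subsetP (sub_span treeE Dl).
apply/set0Pn/(essential_unique_parent treeH dagH (essH _ _ (sD _ cD) (sD _ iD) ciH)).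
exact: reversed_unique_parent Tc out.
Qed.

(** Nodes of Delta on both sides of [i] force the edge [ic] into the span, and the argument for IV
    applies to [c -> i] in [H]. *)
Lemma flip_essential_child i q c : i \in T ->
  (forall a b, a \in S -> b \in S -> (a, b) \in H -> (a, b) \in essential_arcs H) ->
  T :&: parents G i = [set q] -> T :&: children G i = [set c] ->
  (forall K, K \in components (T :\ i) ET -> K :&: Dl != set0) ->
  #|parents G i :\: T| = 0 -> essential_parents H c != set0.
Proof.
move=> iT essH Tq Tc KD out.
have /andP[cT ic] : (c \in T) && ((i, c) \in G).
  by have : c \in [set c] := set11 c; rewrite -Tc in_setI mem_children.
have /andP[qT qi] : (q \in T) && ((q, i) \in G).
  by have : q \in [set q] := set11 q; rewrite -Tq in_setI mem_parents.
have cq : c != q by apply: contraTneq qi => <-; apply: dag_asym ic.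
have ic_neq := tree_neq treeG; have sD := subsetP (sub_span treeE Dl).
have branch x : x \in T -> x != i ->
    exists2 d, d \in S & connect (edge_rel (induced E [set~ i])) x d.
  move=> xT xi; have xTi : x \in T :\ i by rewrite in_setD1 xi.
  have /set0Pn[d /setIP[]] := KD _ (mem_components ET xTi).
  rewrite in_set => /andP[_ xd] dD; exists d; first exact: sD.
  apply: connect_sub xd => u v; rewrite /edge_rel /= inE /= => /and3P[uv uT vT].
  apply: connect1; rewrite /= inE /= (subsetP (diff_edges_sub GH) _ uv) !in_setC1.
  by move: uT vT; rewrite !in_setD1 => /andP[-> _] /andP[-> _].
have iE x : ((x, i) \in G) || ((i, x) \in G) -> (i, x) \in E.
  by rewrite -skG mem_skeleton orbC.
have qE : (i, q) \in E by rewrite iE ?qi.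
have cE : (i, c) \in E by rewrite iE ?ic ?orbT.
have [|d dS qd] := branch q qT; first by rewrite eq_sym (tree_neq treeE).
have [|e eS ce] := branch c cT; first by rewrite eq_sym (tree_neq treeE).
have /andP[iS cS] := subtree_branches treeE (span_tree treeE Dl) cE qE cq eS dS ce qd.
have ciH := edge_reversed GH iT cT ic.
apply: (essential_unique_parent treeH dagH (essH _ _ cS iS ciH)).
exact: reversed_unique_parent Tc out.
Qed.

(** Edges in the span are reversed because it lies in T, so the edge conditions of a flip amount to
    essentiality in both DAGs. A node of Delta rules out Markov equivalence. *)
Lemma essential_flipP : Dl <> set0 ->
  essential_flip E (essential_graph G) (essential_graph H) <->
  (forall a b, a \in S -> b \in S -> (a, b) \in G -> (a, b) \in essential_arcs G) /\
  (forall a b, a \in S -> b \in S -> (a, b) \in H -> (a, b) \in essential_arcs H).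
Proof.
move=> /eqP/set0Pn[i iD]; rewrite /essential_flip (Delta_ess_imset treeE skG skH dagG dagH).
split=> [[_ _ _ _ /subsetP flip]|[essG essH]].
  split=> a b aS bS ab.
    have /flip : (a, b) \in induced E S by rewrite inE /= aS bS -skG mem_skeleton ab.
    rewrite mem_diff_edges => /orP[/andP[->] //|/andP[/(essential_sub treeG dagG) ba _]].
    by case/negP: (dag_asym dagG ab).
  have /flip : (a, b) \in induced E S by rewrite inE /= aS bS -skH mem_skeleton ab.
  rewrite mem_diff_edges => /orP[/andP[_ /(essential_sub treeH dagH) ba]|/andP[_ ->] //].
  by case/negP: (dag_asym dagH ab).
have undir D : skeleton D = E ->
    (forall a b, a \in S -> b \in S -> (a, b) \in D -> (a, b) \in essential_arcs D) ->
    undirected_edges (pinduced (essential_graph D) S) = set0.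
  move=> skD essD; apply/setP => -[a b]; rewrite in_set0; apply/negP.
  rewrite /undirected_edges /pinduced in_set /= ![_ \in induced _ _]in_set /=.
  rewrite mem_skeleton => /and3P[/and3P[abD aS bS]]; rewrite aS bS !andbT.
  by case/orP: abD => /essD -> //; rewrite ?andbF.
split.
- exact: treeE.
- split; [apply/existsP; exists G | apply/existsP; exists H | exact: skG | exact: skH].
    by rewrite dagG eqxx.
  by rewrite dagH eqxx.
- case/(DeltaP _ treeE skG skH): iD => a [b [ab abP]].
  apply: contra abP => /andP[_ /forallP/(_ a)/forallP/(_ i)/forallP/(_ b)].
  rewrite (v_structure_essential_graph treeG dagG) (v_structure_essential_graph treeH dagH).
  by rewrite ab !andbT.
- by split; apply: undir.
apply/subsetP => -[a b]; rewrite in_set /= => /and3P[abE aS bS].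
have aT := span_diff_node GH aS; have bT := span_diff_node GH bS.
have rev := edge_reversed GH.
rewrite mem_diff_edges; move: abE; rewrite -skG mem_skeleton => /orP[] ab.
  have ba := essH b a bS aS (rev a b aT bT ab).
  by apply/orP; left; apply/andP; split; [apply: (essG a b aS bS ab) | apply: ba].
have ab' := essH a b aS bS (rev b a bT aT ab).
by apply/orP; right; apply/andP; split; [apply: (essG b a bS aS ab) | apply: ab'].
Qed.

End Characterization.

(* Each cond_* is void unless i has the corresponding type; internal nodes of
   types I, II and III carry no condition. *)
Theorem theorem2p12 (p : nat) (G H Sk : {set 'I_p * 'I_p})
    (dagG : is_dag G) (dagH : is_dag H)
    (skelG : skeleton G = Sk) (skelH : skeleton H = Sk)
    (treeSk : is_tree [set: 'I_p] Sk)
    (subtreeT : is_tree (diff_nodes G H) (diff_edges G H))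
    (Delta_neq0 : Delta Sk (char_imset G) (char_imset H) <> set0) :
  essential_flip Sk (essential_graph G) (essential_graph H) <->
  (forall i : 'I_p, 2 <= #|[set j | (i, j) \in diff_edges G H]| ->
     [/\ cond_IV G H (diff_nodes G H) i,
         cond_V G H (diff_nodes G H) i
       & cond_VI G H (diff_nodes G H) (diff_edges G H)
           (Delta Sk (char_imset G) (char_imset H)) i]).
Proof.
have GH : differ_on_subtree Sk G H by split.
have HG := differ_on_subtreeC GH.
split=> [/(essential_flipP GH Delta_neq0)[essG essH] i i2|conds].
  have iT : i \in diff_nodes G H.
    by case/card_gt0P: (ltnW i2) => j; rewrite in_set; apply: (tree_meml subtreeT).
  have essGC : forall a b, a \in span Sk (Delta Sk (char_imset H) (char_imset G)) ->
      b \in span Sk (Delta Sk (char_imset H) (char_imset G)) ->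
      (a, b) \in G -> (a, b) \in essential_arcs G by rewrite DeltaC.
  have iTC : i \in diff_nodes H G by rewrite diff_nodesC.
  have paG : diff_nodes G H :&: parents G i = diff_nodes G H :&: children H i.
    by have := parents_inE HG iTC; rewrite diff_nodesC.
  have chG := parents_inE GH iT.
  split.
  - exact: (flip_cond_IV GH iT essH).
  (* Condition V is condition IV for the exchanged DAGs. *)
  - have := flip_cond_IV HG iTC essGC.
    rewrite /cond_IV /cond_V diff_nodesC chG -paG (parents_outE GH).
    by move=> c4 q Tq Tc; apply: c4.
  - move=> q c Tq Tc KD.
    have [out|out] := posnP #|parents G i :\: diff_nodes G H|; [right | by left].
    split; apply/set0Pn; first exact: (flip_essential_child GH iT essH Tq Tc KD out).
    (* After the exchange, [c] is the T-parent of [i] and [q] its T-child. *)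
    apply: (flip_essential_child HG iTC essGC (q := c)).
    + by rewrite diff_nodesC chG.
    + by rewrite diff_nodesC -paG.
    + by rewrite diff_nodesC diff_edgesC DeltaC.
    + by rewrite diff_nodesC (parents_outE GH).
apply/(essential_flipP GH Delta_neq0); split=> a b aS bS.
  exact: (flip_conds_essential GH conds aS bS).
apply: (flip_conds_essential HG); rewrite 1?DeltaC // => i.
rewrite diff_edgesC => i2; apply: (flip_condsC GH) (conds i i2).
by case/card_gt0P: (ltnW i2) => j; rewrite in_set; apply: (tree_meml subtreeT).
Qed.
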